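(* For any integer $m\ge 3$, the labeled graph on $v_1,\dots,v_{m+2}$ obtained by adding the edge $v_2v_{m+1}$ to the cycle $v_1v_2\dotsm v_{m+2}v_1$ (a cycle of length $m$ and a cycle of length $4$ sharing exactly one edge) is $(e)$-positive.
   Context: Let $G$ be a finite simple graph with vertices labeled $v_1,\dots,v_d$. Its chromatic symmetric function in noncommuting variables is $Y_G=\sum_\kappa x_{\kappa(v_1)}x_{\kappa(v_2)}\dotsm x_{\kappa(v_d)}$, where $x_1,x_2,\dots$ are noncommuting variables and the sum is over all proper colorings $\kappa\colon V(G)\to\{1,2,3,\dots\}$. Let $\Pi_d$ be the set of set partitions of $[d]=\{1,\dots,d\}$. For $\pi\in\Pi_d$, let $e_\pi=\sum_{(i_1,\dots,i_d)}x_{i_1}\dotsm x_{i_d}$, where the sum is over all sequences $(i_1,\dots,i_d)$ of positive integers such that $i_j\ne i_k$ whenever $j\neq k$ lie in the same block of $\pi$. The $e_\pi$, $\pi\in\Pi_d$, are linearly independent over $\mathbb{Q}$ and $Y_G$ is uniquely a rational linear combination $Y_G=\sum_{\sigma\in\Pi_d}c_\sigma e_\sigma$. The type $\lambda(\pi)$ is the integer partition of $d$ formed by the block sizes of $\pi$, and $b_\pi$ is the size of the block of $\pi$ containing $d$. Write $\pi\equiv\sigma$ if $\lambda(\pi)=\lambda(\sigma)$ and $b_\pi=b_\sigma$; let $(\pi)$ be the equivalence class of $\pi$, and set $c_{(\pi)}=\sum_{\sigma\in(\pi)}c_\sigma$. The labeled graph $G$ is called $(e)$-positive if $c_{(\pi)}\ge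 0$ for every equivalence class $(\pi)\subseteq\Pi_d$. Here $d=m+2$. *)

(* Defs.v *)
From mathcomp Require Import all_boot all_order all_algebra.

Set Implicit Arguments.
Unset Strict Implicit.
Unset Printing Implicit Defensive.

Import GRing.Theory Num.Theory.
Local Open Scope ring_scope.

(* Vertex [v_k] of a labeled graph on [d] vertices, and the element [k] of
   {1, ..., d}, are the ordinal of value [k - 1] in ['I_d].  A graph is given by
   its adjacency relation.

   All series below are homogeneous of degree [d] in the noncommuting variables
   x_1, x_2, ..., so a series is the function giving the coefficient of each word
   of length [d]; the letter [i : nat] stands for the variable x_(i+1). *)

Definition ncseries (d : nat) := d.-tuple nat -> rat.

Definition proper_coloring (d : nat) (G : rel 'I_d) (kappa : 'I_d -> nat) : bool :=
  [forall i, forall j, G i j ==> (kappa i != kappa j)].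

(* A coloring [kappa] is determined by its monomial
   x_(kappa v_1) ... x_(kappa v_d), so each coefficient is 0 or 1. *)
Definition chromatic_ncsym (d : nat) (G : rel 'I_d) : ncseries d :=
  fun w => (proper_coloring G (tnth w))%:R.

Definition set_partitions (d : nat) : {set {set {set 'I_d}}} :=
  [set pi | partition pi [set: 'I_d]].

Definition ncsym_e (d : nat) (pi : {set {set 'I_d}}) : ncseries d :=
  fun w => [forall j, forall k,
    (j != k) && (pblock pi j == pblock pi k) ==> (tnth w j != tnth w k)]%:R.

Definition e_expansion (d : nat) (f : ncseries d) (c : {set {set 'I_d}} -> rat) :=
  forall w : d.-tuple nat,
    f w = \sum_(sigma in set_partitions d) c sigma * ncsym_e sigma w.

Definition partition_type (d : nat) (pi : {set {set 'I_d}}) : seq nat :=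
  sort geq [seq #|B| | B : {set 'I_d} in pi].

Definition last_block_size (n : nat) (pi : {set {set 'I_n.+1}}) : nat :=
  #|pblock pi ord_max|.

Definition partition_equiv (n : nat) : rel {set {set 'I_n.+1}} :=
  fun pi sigma => (partition_type pi == partition_type sigma)
               && (last_block_size pi == last_block_size sigma).

Definition class_coef (n : nat) (c : {set {set 'I_n.+1}} -> rat)
    (pi : {set {set 'I_n.+1}}) : rat :=
  \sum_(sigma in set_partitions n.+1 | partition_equiv pi sigma) c sigma.

(* The [ncsym_e pi] are linearly independent (Rosas and Sagan), so there is only
   one expansion [c] on [set_partitions n.+1]; the existential just names it. *)
Definition class_e_positive (n : nat) (G : rel 'I_n.+1) : Prop :=
  exists c : {set {set 'I_n.+1}} -> rat,
    e_expansion (chromatic_ncsym G) c /\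
    forall pi, pi \in set_partitions n.+1 -> 0 <= class_coef c pi.

(* The chord joins v_2 and v_(m+1), which are the ordinals 1 and m. *)
Definition chorded_cycle (m : nat) : rel 'I_m.+2 :=
  let edge (i j : 'I_m.+2) := (j == ordS i) || (i == 1%N :> nat) && (j == m :> nat) in
  fun i j => edge i j || edge j i.

Lemma chorded_cycle_sym (m : nat) : symmetric (@chorded_cycle m).
Proof. by move=> i j; rewrite /chorded_cycle orbC. Qed.

Lemma chorded_cycle_irr (m : nat) : (2 < m)%N -> irreflexive (@chorded_cycle m).
Proof.
move=> m_gt2 i; rewrite /chorded_cycle orbb; apply/negbTE; rewrite negb_or.
apply/andP; split; last first.
  apply/negP=> /andP[/eqP i1 /eqP im]; by rewrite -im i1 in m_gt2.
apply/eqP=> /(congr1 val) /=.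
have := ltn_ord i; rewrite leq_eqVlt => /orP[|lt_i].
  by rewrite eqSS => /eqP ->; rewrite modnn.
by rewrite modn_small // => /n_Sn.
Qed.

(* Main.v *)
Require Import Defs.
From mathcomp Require Import all_boot all_order all_algebra.
From mathcomp Require Import all_fingroup.
From mathcomp Require Import ring mpoly.

Set Implicit Arguments.
Unset Strict Implicit.
Unset Printing Implicit Defensive.

Import GRing.Theory Num.Theory.
Local Open Scope ring_scope.

(* Permuting the first d - 1 positions does not change the class of a partition,
   so the class sums of Y_G can be read off after averaging over these
   permutations, that is, after letting the variables commute while remembering
   the color i of the last vertex.  Then e_pi becomes, up to a positive factor,
   x_i e'_(b-1) times a product of e_k, where e'_k is e_k in the variables other
   than x_i and b is the size of the last block.

   Let r_n be the coefficient of u^n in 1 / (1 - sum_j j e_(j+1) u^(j+1)).  The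
   pointed n-cycle becomes x_i sum_j j e'_j r_(n-1-j).  Deleting and contracting
   the chord and reducing with x_i e'_k = e_(k+1) - e'_(k+1) gives for Y_G / x_i
     r_m e'_1 + sum_(j >= 3) j e'_j r_(m+1-j)
     + sum_(j >= 1) j r_(m-2-j) ((j+1) e_(j+3) + j e_(j+2) e'_1
                                 + e_1 e'_(j+2) + 2 e'_(j+3)),
   which is positive term by term.

   That Y_G has some expansion follows from e_pi(w) = det [i ~ j and w_i = w_j],
   a signed sum over permutations preserving the blocks of pi. *)

(** * Walks and elementary symmetric polynomials *)

Section ElementarySymmetric.

Variables (R : comNzRingType) (N : nat) (x : 'I_N -> R).

(** A coefficient of a product with one factor per variable, so that deleting a variable is deleting
    a factor. *)
Definition elsym (S : {set 'I_N}) (k : nat) : R :=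
  (\prod_(j in S) (1 + x j *: 'X))`_k.

Lemma elsym0 (S : {set 'I_N}) : elsym S 0 = 1.
Proof.
rewrite /elsym -horner_coef0 horner_prod big1 // => j _.
by rewrite hornerD hornerZ hornerX hornerC mulr0 addr0.
Qed.

Lemma elsymS (S : {set 'I_N}) (i : 'I_N) (k : nat) : i \in S ->
  elsym S k.+1 = elsym (S :\ i) k.+1 + x i * elsym (S :\ i) k.
Proof.
move=> iS; rewrite /elsym (big_setD1 i) //= mulrDl mul1r coefD.
by rewrite -scalerAl coefZ coefXM.
Qed.

Lemma elsym_set0 (k : nat) : elsym set0 k.+1 = 0.
Proof. by rewrite /elsym big_set0 coef1. Qed.

(** Each squarefree monomial of degree k + 1 is counted once for each of its variables. The
    induction on the size of [S] removes one variable [j]. *)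
Lemma sum_elsymD1 (S : {set 'I_N}) (k : nat) :
  \sum_(i in S) x i * elsym (S :\ i) k = k.+1%:R * elsym S k.+1.
Proof.
elim: {S}_.+1 {-2}S (ltnSn #|S|) k => // n IHn S; rewrite ltnS => leSn k.
case: (set_0Vmem S) => [-> | [j jS]]; first by rewrite big_set0 elsym_set0 mulr0.
have ltSn : (#|S :\ j| < n)%N by rewrite (cardsD1 j) jS in leSn.
have SDC i : S :\ i :\ j = S :\ j :\ i by rewrite !setDDl setUC.
have inS i : i \in S :\ j -> j \in S :\ i.
  by rewrite !inE jS eq_sym andbT => /andP[].
rewrite (big_setD1 j) //= (elsymS _ jS).
case: k => [|k].
  have sum0 (A : {set _}) : \sum_(i in A) x i * elsym (A :\ i) 0 = \sum_(i in A) x i * 1.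
    by apply: eq_bigr => i _; rewrite elsym0.
  rewrite [X in _ + X](_ : _ = \sum_(i in S :\ j) x i * 1).
    by rewrite -sum0 IHn // !elsym0; ring.
  by apply: eq_bigr => i _; rewrite elsym0.
have eqS i : i \in S :\ j -> x i * elsym (S :\ i) k.+1 =
    x i * elsym (S :\ j :\ i) k.+1 + x j * (x i * elsym (S :\ j :\ i) k).
  by move=> /inS /elsymS ->; rewrite SDC; ring.
rewrite (eq_bigr _ eqS) big_split -mulr_sumr !IHn //=.
by rewrite -!natr1; ring.
Qed.

Local Notation e := (elsym setT).
Local Notation e' y := (elsym [set~ y]).

Lemma elsym_point (y : 'I_N) (k : nat) : x y * e' y k = e k.+1 - e' y k.+1.
Proof. by rewrite (@elsymS setT y) ?inE // setTD addrAC subrr add0r. Qed.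

Lemma point_elsym1 (y : 'I_N) : x y = e 1%N - e' y 1%N.
Proof. by rewrite -elsym_point elsym0 mulr1. Qed.

Lemma sum_point_elsym (k : nat) : \sum_y x y * e' y k = k.+1%:R * e k.+1.
Proof.
rewrite -sum_elsymD1 [RHS](eq_bigl xpredT); last by move=> i; rewrite inE.
by apply: eq_bigr => i _; rewrite setTD.
Qed.

Lemma sum_points : \sum_y x y = e 1%N.
Proof.
by have := sum_point_elsym 0; under eq_bigr do rewrite elsym0 mulr1; rewrite mul1r.
Qed.

(* [path_coefs n] lists [path_coef n], ..., [path_coef 0]. *)
Fixpoint path_coefs (n : nat) : seq R :=
  if n is n'.+1 then
    \sum_(j < n'.+1) j%:R * e j.+1 * (path_coefs n')`_j :: path_coefs n'
  else [:: 1].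

(* [path_coef n] is the coefficient of u^n in 1 / (1 - \sum_j j e_(j+1) u^(j+1)). *)
Definition path_coef (n : nat) : R := head 0 (path_coefs n).

Lemma nth_path_coefs (n j : nat) : (j <= n)%N ->
  (path_coefs n)`_j = path_coef (n - j).
Proof.
elim: n j => [|n IHn] [|j] //=; rewrite ltnS => lejn.
by rewrite IHn.
Qed.

(** The coefficient of u^n in (sum_j F_j u^(j+1)) (sum_l r_l u^l), where r_l is [path_coef l]. *)
Definition conv (F : nat -> R) (n : nat) : R :=
  \sum_(j < n) F j * path_coef (n - j.+1).

Lemma path_coefS (n : nat) : path_coef n.+1 = conv (fun j => j%:R * e j.+1) n.+1.
Proof.
by apply: eq_bigr => j _; rewrite nth_path_coefs ?subSS // -ltnS.
Qed.

Lemma convS (F : nat -> R) (n : nat) :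
  conv F n.+1 = F 0%N * path_coef n + conv (F \o succn) n.
Proof.
by rewrite /conv big_ord_recl subSS subn0.
Qed.

Lemma eq_conv (F G : nat -> R) : F =1 G -> conv F =1 conv G.
Proof. by move=> eqFG n; apply: eq_bigr => j _; rewrite eqFG. Qed.

Lemma convD (F G : nat -> R) (n : nat) :
  conv (fun j => F j + G j) n = conv F n + conv G n.
Proof. by rewrite /conv -big_split; apply: eq_bigr => j _; rewrite mulrDl. Qed.

Lemma convZ (a : R) (F : nat -> R) (n : nat) :
  conv (fun j => a * F j) n = a * conv F n.
Proof. by rewrite /conv mulr_sumr; apply: eq_bigr => j _; rewrite mulrA. Qed.

Lemma conv_sum (F : 'I_N -> nat -> R) (n : nat) (P : pred 'I_N) :
  conv (fun j => \sum_(y | P y) F y j) n = \sum_(y | P y) conv (F y) n.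
Proof.
by rewrite /conv exchange_big; apply: eq_bigr => j _; rewrite mulr_suml.
Qed.

(** * Walks with consecutive letters distinct *)

(* [iter n walk g b] sums, over the walks [a_1, ..., a_n] with consecutive
   letters of [b, a_1, ..., a_n] distinct, the weight of [a_1 ... a_n] times the
   value of [g] at the last letter. *)
Definition walk (g : 'I_N -> R) (b : 'I_N) : R := \sum_(a | a != b) x a * g a.

Definition delta (y b : 'I_N) : R := (b == y)%:R.

(** The proper colorings of an (n + 1)-cycle with one vertex colored [y], the factor [x y] of that
    vertex being left out. For n = 0 the value is zero. *)
Definition closed_walk (n : nat) (y : 'I_N) : R :=
  iter n walk (fun b => 1 - delta y b) y.

Lemma iter_walkS (n : nat) (g : 'I_N -> R) (b : 'I_N) :
  iter n.+1 walk g b = \sum_(a | a != b) x a * iter n walk g a.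
Proof. by []. Qed.

Lemma eq_iter_walk (n : nat) (g h : 'I_N -> R) :
  g =1 h -> iter n walk g =1 iter n walk h.
Proof.
move=> eqgh; elim: n => // n IHn b; rewrite !iter_walkS.
by apply: eq_bigr => a _; rewrite IHn.
Qed.

Lemma iter_walk_sum (I : finType) (P : pred I) (n : nat) (a : I -> R)
    (g : I -> 'I_N -> R) (b : 'I_N) :
  iter n walk (fun c => \sum_(i | P i) a i * g i c) b
  = \sum_(i | P i) a i * iter n walk (g i) b.
Proof.
elim: n b => // n IHn b; rewrite !iter_walkS.
under eq_bigr do rewrite IHn mulr_sumr.
rewrite exchange_big; apply: eq_bigr => i _; rewrite iter_walkS mulr_sumr.
by apply: eq_bigr => c _; ring.
Qed.

Lemma iter_walkB (n : nat) (a : R) (g h : 'I_N -> R) (b : 'I_N) :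
  iter n walk (fun c => g c - a * h c) b
  = iter n walk g b - a * iter n walk h b.
Proof.
elim: n b => // n IHn b; rewrite !iter_walkS.
under eq_bigr do rewrite IHn.
by rewrite mulr_sumr -sumrB; apply: eq_bigr => c _; ring.
Qed.

Lemma walk_delta (y b : 'I_N) : walk (delta y) b = x y * (1 - delta b y).
Proof.
rewrite /walk /delta; have [<- | neqyb] := eqVneq y b.
  by rewrite subrr mulr0 big1 // => a /negPf ->; rewrite mulr0.
rewrite (bigD1 y) //= eqxx subr0 big1 ?addr0 // => a /andP[_ /negPf ->].
by rewrite mulr0.
Qed.

Lemma sum_delta (y b : 'I_N) : \sum_(c | c != y) delta c b = 1 - delta y b.
Proof.
rewrite /delta; have [-> | neqby] := eqVneq b y.
  by rewrite subrr big1 // => a /negPf; rewrite eq_sym => ->.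
rewrite (bigD1 b) //= eqxx subr0 big1 ?addr0 // => a /andP[_ /negPf].
by rewrite eq_sym => ->.
Qed.

Lemma iter_walk_sum_delta (n : nat) (y b : 'I_N) :
  iter n walk (fun c => 1 - delta y c) b
  = \sum_(c | c != y) iter n walk (delta c) b.
Proof.
under eq_iter_walk => c.
  rewrite -sum_delta; under eq_bigr do rewrite -[delta _ _]mul1r.
  over.
by rewrite iter_walk_sum; apply: eq_bigr => c _; rewrite mul1r.
Qed.

(** Reversal of walks: with the starting letter weighted as well, the walks from [a] to [y] and
    those from [y] to [a] have the same monomials. *)
Lemma iter_walk_delta_sym (n : nat) (a y : 'I_N) :
  x a * iter n walk (delta y) a = x y * iter n walk (delta a) y.
Proof.
elim: n a y => [|n IHn] a y.
  by rewrite /delta /= eq_sym; case: eqVneq => [-> | _] //; rewrite !mulr0.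
have -> : iter n.+1 walk (delta a) y = iter n walk (walk (delta a)) y.
  by rewrite iterSr.
under [in RHS]eq_iter_walk => b do rewrite walk_delta /delta eq_sym -/(delta _ _).
have -> : iter n walk (fun b => x a * (1 - delta a b)) y
          = x a * iter n walk (fun b => 1 - delta a b) y.
  have := iter_walk_sum (I := 'I_1) xpredT n (fun _ => x a)
    (fun _ b => 1 - delta a b) y.
  by rewrite big_ord1 => <-; apply: eq_iter_walk => b; rewrite big_ord1.
rewrite iter_walk_sum_delta iter_walkS mulrCA !mulr_sumr; apply: eq_bigr => c _.
by rewrite IHn.
Qed.

(** A walk returning to [y] ends with a letter of weight [x y]; what precedes that letter is a
    closed walk. *)
Lemma iter_walk_loop (n : nat) (y : 'I_N) :
  iter n.+1 walk (delta y) y = x y * closed_walk n y.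
Proof.
rewrite iter_walkS; under eq_bigr do rewrite iter_walk_delta_sym.
by rewrite -mulr_sumr -iter_walk_sum_delta.
Qed.

Lemma walkE (g : 'I_N -> R) (b : 'I_N) :
  walk g b = \sum_a x a * g a - x b * g b.
Proof. by rewrite [X in X - _](bigD1 b) //= addrC addrK. Qed.

(** In the step from n to n + 1, dropping the condition on the first letter and subtracting the
    excess turns e'_j into (j+1) e_(j+1) - (e_(j+1) - e'_(j+1)). The parts j e_(j+1) add up to
    r_(n+1). *)
Lemma open_walkE (n : nat) (y : 'I_N) :
  iter n walk (fun=> 1) y = conv (e' y) n.+1.
Proof.
elim: n y => [|n IHn] y.
  by rewrite /conv big_ord1 elsym0 mul1r.
rewrite iterS walkE; under eq_bigr do rewrite IHn.
rewrite IHn -convZ.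
have -> : \sum_a x a * conv (e' a) n.+1 = conv (fun j => j.+1%:R * e j.+1) n.+1.
  under eq_bigr do rewrite -convZ.
  by rewrite -conv_sum; apply: eq_conv => j; rewrite sum_point_elsym.
rewrite -[X in _ - X]mul1r -mulNr -convZ -convD [RHS]convS elsym0 mul1r.
rewrite path_coefS -convD; apply: eq_conv => j /=.
by rewrite elsym_point -natr1; ring.
Qed.

(** A walk from [y] either ends away from [y], and is closed, or returns to [y], and is [x y] times
    a shorter closed walk. This recursion is solved with x_y e'_j = e_(j+1) - e'_(j+1). *)
Lemma closed_walkE (n : nat) (y : 'I_N) :
  closed_walk n y = conv (fun j => j%:R * e' y j) n.+1.
Proof.
have cwE k : closed_walk k y = iter k walk (fun=> 1) y - iter k walk (delta y) y.
  rewrite -[X in _ - X]mul1r -iter_walkB.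
  by apply: eq_iter_walk => b; rewrite mul1r.
elim: n => [|n IHn]; first by rewrite cwE /conv big_ord1 /= /delta eqxx subrr !mul0r.
rewrite cwE iter_walk_loop open_walkE IHn -convZ.
rewrite !(convS _ n.+1) elsym0 mul1r !mul0r add0r path_coefS.
rewrite -[X in _ - X]mul1r -mulNr -convZ -!convD; apply: eq_conv => j /=.
have -> : x y * (j%:R * e' y j) = j%:R * (x y * e' y j) by ring.
by rewrite elsym_point -natr1; ring.
Qed.

(* The left-hand side is the cycle on [k + 3] vertices minus the graph obtained by
   identifying the two ends of the chord.  The only negative contribution left,
   [- 2 e'_2 path_coef k], cancels against the term [j = 2] of
   [closed_walk k.+2]. *)
Lemma closed_walk_chord (k : nat) (i : 'I_N) : (1 < k)%N ->
  closed_walk k.+2 i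
    - \sum_(b | b != i) x b * (e 1%N - x i - x b) * (x b * closed_walk k.-1 b)
  = e' i 1%N * path_coef k.+1
    + conv (fun j => j.+3%:R * e' i j.+3) k
    + conv (fun j => j%:R * (j.+1%:R * e j.+3 + j%:R * (e j.+2 * e' i 1%N)
                             + e 1%N * e' i j.+2 + 2%:R * e' i j.+3)) k.
Proof.
move=> k_gt1; have k_gt0 := ltnW k_gt1.
(* The terms j = 0, 1, 2 are split off, leaving convolutions of length [k] to be compared term by
   term. *)
rewrite closed_walkE 3!convS /= !mul0r add0r mul1r.
have -> : \sum_(b | b != i) x b * (e 1%N - x i - x b) * (x b * closed_walk k.-1 b)
  = conv (fun j => \sum_(b | b != i)
      x b * (e 1%N - x i - x b) * x b * (j%:R * e' b j)) k.
  rewrite conv_sum; apply: eq_bigr => b _.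
  by rewrite closed_walkE prednK // mulrA convZ.
rewrite -!addrA; congr (_ + _).
have -> : path_coef k = conv (fun j => j%:R * e j.+1) k.
  by case: (k) k_gt0 => // k' _; exact: path_coefS.
rewrite -convZ addrCA; congr (_ + _).
rewrite -[X in _ - X]mul1r -mulNr -convZ -convD; apply: eq_conv => j /=.
(* Extending the sum to b = i leaves sums over all b, computed by [sum2] and [sum_sq] below, and a
   correction at b = i. *)
have -> : \sum_(b | b != i) x b * (e 1%N - x i - x b) * x b * (j%:R * e' b j)
  = j%:R * (e' i 1%N * (\sum_b x b * (x b * e' b j))
            - \sum_b x b * (x b * (x b * e' b j))
            - (e 1%N - 2%:R * x i) * (x i * (x i * e' i j))).
  have -> : e' i 1%N = e 1%N - x i by rewrite [x i]point_elsym1; ring.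
  have -> : \sum_(b | b != i) x b * (e 1%N - x i - x b) * x b * (j%:R * e' b j)
    = \sum_b x b * (e 1%N - x i - x b) * x b * (j%:R * e' b j)
      - x i * (e 1%N - x i - x i) * x i * (j%:R * e' i j).
    by rewrite [X in _ = X - _](bigD1 i) //= addrC addrK.
  have -> : \sum_b x b * (e 1%N - x i - x b) * x b * (j%:R * e' b j)
    = j%:R * ((e 1%N - x i) * (\sum_b x b * (x b * e' b j))
              - \sum_b x b * (x b * (x b * e' b j))).
    by rewrite mulr_sumr -sumrB mulr_sumr; apply: eq_bigr => b _; ring.
  by ring.
have sum2 l : \sum_b x b * (x b * e' b l) = e 1%N * e l.+1 - l.+2%:R * e l.+2.
  under eq_bigr do rewrite elsym_point mulrBr.
  by rewrite sumrB -mulr_suml sum_points sum_point_elsym.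
have sum_sq : \sum_b x b * x b = e 1%N * e 1%N - 2%:R * e 2%N.
  by rewrite -sum2; apply: eq_bigr => b _; rewrite elsym0 mulr1.
have -> : \sum_b x b * (x b * (x b * e' b j))
  = (e 1%N * e 1%N - 2%:R * e 2%N) * e j.+1 - (e 1%N * e j.+2 - j.+3%:R * e j.+3).
  under eq_bigr do rewrite elsym_point !mulrBr mulrA.
  by rewrite sumrB -mulr_suml sum_sq sum2.
rewrite sum2 elsym_point [x i * (_ - _)]mulrBr elsym_point.
(* Expanded so that x_i^2 and x_i e'_(j+2) appear and can be reduced; every remaining [x i] becomes
   e_1 - e'_1. *)
have -> : (e 1%N - 2%:R * x i) * (x i * e j.+1 - (e j.+2 - e' i j.+2)) =
   e 1%N * (x i * e j.+1 - (e j.+2 - e' i j.+2)) - 2%:R *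
  ((x i * x i) * e j.+1 - x i * e j.+2 + x i * e' i j.+2) by ring.
have -> : x i * x i = e 1%N * x i - (e 2%N - e' i 2%N).
  rewrite -elsym_point {2}[x i]point_elsym1; ring.
rewrite elsym_point [x i]point_elsym1.
rewrite -!natr1; ring.
Qed.

End ElementarySymmetric.

(** * Pointed commutative images *)

(* The adjacency conditions of [chorded_cycle m] on a word of length [m + 2]. *)
Definition chorded_word (T : eqType) (x0 : T) (m : nat) (w : seq T) : bool :=
  [&& sorted (fun a b => b != a) w, nth x0 w 0 != nth x0 w m.+1
    & nth x0 w 1 != nth x0 w m].

Section WordSums.

Variables (R : comAlgType rat) (N : nat) (x : 'I_N -> R).

Local Notation e := (elsym x setT).
Local Notation e' y := (elsym x [set~ y]).

Fixpoint wsum (k : nat) (F : seq 'I_N -> R) : R :=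
  if k is k'.+1 then \sum_a wsum k' (fun w => F (a :: w)) else F [::].

Definition mon (w : seq 'I_N) : R := \prod_(a <- w) x a.

Lemma mon_cons (a : 'I_N) (w : seq 'I_N) : mon (a :: w) = x a * mon w.
Proof. exact: big_cons. Qed.

Lemma mon_cat (u v : seq 'I_N) : mon (u ++ v) = mon u * mon v.
Proof. exact: big_cat. Qed.

Lemma eq_wsum (k : nat) (F G : seq 'I_N -> R) :
  (forall w, size w = k -> F w = G w) -> wsum k F = wsum k G.
Proof.
elim: k F G => [|k IHk] F G eqFG; first exact: eqFG.
by apply: eq_bigr => a _; apply: IHk => w sz_w; apply: eqFG; rewrite /= sz_w.
Qed.

Lemma wsum_cat (k l : nat) (F : seq 'I_N -> R) :
  wsum (k + l) F = wsum k (fun u => wsum l (fun v => F (u ++ v))).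
Proof. by elim: k F => //= k IHk F; apply: eq_bigr => a _; rewrite IHk. Qed.

Lemma wsum_mull (k : nat) (c : R) (F : seq 'I_N -> R) :
  wsum k (fun w => c * F w) = c * wsum k F.
Proof.
elim: k F => //= k IHk F.
by rewrite mulr_sumr; apply: eq_bigr => a _; rewrite IHk.
Qed.

Lemma wsum_mulr (k : nat) (c : R) (F : seq 'I_N -> R) :
  wsum k (fun w => F w * c) = wsum k F * c.
Proof.
by rewrite mulrC -wsum_mull; apply: eq_wsum => w _; rewrite mulrC.
Qed.

(** A set of k letters has k! orderings; the induction chooses the first letter and removes it from
    [S]. *)
Lemma wsum_uniq (S : {set 'I_N}) (k : nat) :
  wsum k (fun w => (uniq w && all (mem S) w)%:R * mon w) = k`!%:R * elsym x S k.
Proof.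
elim: k S => [|k IHk] S /=; first by rewrite /mon big_nil elsym0.
rewrite factS natrM mulrAC -sum_elsymD1 mulr_suml [RHS]big_mkcond /=.
apply: eq_bigr => a _.
transitivity (wsum k (fun w => (a \in S)%:R * x a *
    ((uniq w && all (mem (S :\ a)) w)%:R * mon w))).
  apply: eq_wsum => w _; rewrite mon_cons.
  have -> : (a \notin w) && uniq w && ((a \in S) && all (mem S) w)
            = (a \in S) && (uniq w && all (mem (S :\ a)) w).
    have -> : all (mem (S :\ a)) w = (a \notin w) && all (mem S) w.
      elim: w => //= b w ->; rewrite !inE negb_or eq_sym.
      by case: (_ == _) => //=; case: (b \in S) => //; rewrite andbF.
    by case: (a \in S); case: (a \in w); case: (uniq w).
  by rewrite -mulnb natrM; ring.
rewrite wsum_mull IHk; case: (a \in S); rewrite ?mul0r // mul1r; ring.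
Qed.

Lemma wsum_path (k : nat) (g : 'I_N -> R) (b : 'I_N) :
  wsum k (fun u => (path (fun a c => c != a) b u)%:R * (g (last b u) * mon u))
  = iter k (walk x) g b.
Proof.
elim: k b => [|k IHk] b; first by rewrite /= /mon big_nil mul1r mulr1.
rewrite iter_walkS /= [RHS]big_mkcond; apply: eq_bigr => a _ /=.
rewrite -IHk; case: (a != b) => /=.
  by rewrite -wsum_mull; apply: eq_wsum => w _; rewrite mon_cons; ring.
rewrite -[RHS](mul0r (wsum k (fun=> 0))) -wsum_mull.
by apply: eq_wsum => w _; rewrite !mul0r.
Qed.

(** Write the word as a, b, u, i. The chord joins b to the last letter of u, and the indicator that
    they differ is 1 minus the indicator that they agree. If they agree, u closes a k-cycle through
    b, and a has to avoid i and b. *)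
Lemma wsum_chorded (k : nat) (i : 'I_N) : (0 < k)%N ->
  wsum k.+2 (fun v => (chorded_word i k.+1 (rcons v i))%:R * mon v)
  = closed_walk x k.+2 i
    - \sum_(b | b != i) x b * (e 1%N - x i - x b) * (x b * closed_walk x k.-1 b).
Proof.
move=> k_gt0.
have chord_sum a b :
    wsum k (fun u => (chorded_word i k.+1 (rcons [:: a, b & u] i))%:R
                     * mon [:: a, b & u])
    = (a != i)%:R * x a * ((b != a)%:R * x b *
       (iter k (walk x) (fun c => 1 - delta R i c) b
        - (b != i)%:R * (x b * closed_walk x k.-1 b))).
  have -> : x b * closed_walk x k.-1 b = iter k (walk x) (delta R b) b.
    by case: (k) k_gt0 => // k' _; rewrite -iter_walk_loop.
  rewrite -iter_walkB -wsum_path -!wsum_mull; apply: eq_wsum => u sz_u.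
  rewrite /chorded_word /= rcons_path !nth_rcons sz_u ltnn eqxx !mon_cons.
  have -> : nth i (b :: rcons u i) k = last b u.
    by rewrite -rcons_cons nth_rcons /= sz_u ltnS leqnn (last_nth i) sz_u.
  rewrite /delta (eq_sym i) (eq_sym b (last b u)).
  set P := path _ _ _; set l := last b u.
  case: (eqVneq b a) => _ /=; rewrite ?mul0r ?mulr0 ?mul0r //.
  case: (eqVneq a i) => _ /=; rewrite ?andbF ?mul0r //.
  case: P => /=; rewrite ?mul0r ?mulr0 //.
  case: (eqVneq l i) => [-> | neq_li] /=.
    by rewrite (eq_sym i b); case: (b == i) => /=; ring.
  case: (eqVneq l b) neq_li => [-> -> | _ _] /=; ring.
transitivity (\sum_a \sum_b (a != i)%:R * x a * ((b != a)%:R * x b *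
       (iter k (walk x) (fun c => 1 - delta R i c) b
        - (b != i)%:R * (x b * closed_walk x k.-1 b)))).
  by apply: eq_bigr => a _; apply: eq_bigr => b _; exact: chord_sum.
transitivity (\sum_(a | a != i) (x a *
     \sum_(b | b != a) (x b * iter k (walk x) (fun c => 1 - delta R i c) b))
   - \sum_b (\sum_a (a != i)%:R * x a * (b != a)%:R) * x b * (b != i)%:R *
       (x b * closed_walk x k.-1 b)).
  rewrite [X in X - _]big_mkcond /=.
  under [X in _ - X]eq_bigr do rewrite !mulr_suml.
  rewrite [X in _ - X]exchange_big -sumrB; apply: eq_bigr => a _.
  have -> : (if a != i then x a * \sum_(b | b != a) (x b *
       iter k (walk x) (fun c => 1 - delta R i c) b) else 0)
    = \sum_b (a != i)%:R * x a * ((b != a)%:R * x b *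
         iter k (walk x) (fun c => 1 - delta R i c) b).
    rewrite -mulr_sumr (big_mkcond (fun b => b != a)) /=.
    case: (a != i); rewrite ?mul0r // mul1r; congr (_ * _).
    by apply: eq_bigr => b _; case: (b != a); rewrite ?mul1r ?mul0r.
  by rewrite -sumrB; apply: eq_bigr => b _; ring.
congr (_ - _); rewrite [RHS]big_mkcond; apply: eq_bigr => b _ /=.
case: (eqVneq b i) => [|neq_bi] /=; first by rewrite mulr0 mul0r.
have -> : \sum_a (a != i)%:R * x a * (b != a)%:R = e 1%N - x i - x b.
  rewrite -sum_points (bigD1 i) //= (bigD1 b) //= !eqxx mul0r mul0r mulr0 !add0r.
  rewrite [in RHS](bigD1 i) //= [in RHS](bigD1 b) //=.
  rewrite (eq_bigr x) => [|a /andP[ai ab]]; first by ring.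
  by rewrite ai eq_sym ab mul1r mulr1.
by rewrite mulr1; ring.
Qed.

(** * Clique sums and their nonnegative combinations *)

(* [uniq (zip cs w)] says that letters of [w] in positions of the same color in
   [cs] are distinct, so this is the commutative image of the words of e_pi with
   last letter [i], where the factor [x i] of that letter is dropped. *)
Definition clique_sum (n : nat) (cs : seq nat) (i : 'I_N) : R :=
  wsum n (fun v => (uniq (zip cs (rcons v i)))%:R * mon v).

(** One list of weighted color sequences has to serve every last letter [i]. *)
Definition epos (n : nat) (F : 'I_N -> R) : Prop :=
  exists2 s : seq (rat * seq nat),
    all (fun q => (0 <= q.1) && (size q.2 == n.+1)) s
    & forall i, F i = \sum_(q <- s) q.1 *: clique_sum n q.2 i.

Lemma eq_epos (n : nat) (F G : 'I_N -> R) : F =1 G -> epos n F -> epos n G.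
Proof. by move=> eqFG [s s_ok FE]; exists s => // i; rewrite -eqFG. Qed.

Lemma epos_0 (n : nat) : epos n (fun=> 0).
Proof. by exists [::] => // i; rewrite big_nil. Qed.

Lemma eposD (n : nat) (F G : 'I_N -> R) :
  epos n F -> epos n G -> epos n (fun i => F i + G i).
Proof.
move=> [s s_ok FE] [t t_ok GE]; exists (s ++ t); first by rewrite all_cat s_ok.
by move=> i; rewrite big_cat FE GE.
Qed.

Lemma epos_nat (n c : nat) (F : 'I_N -> R) :
  epos n F -> epos n (fun i => c%:R * F i).
Proof.
move=> Fpos; elim: c => [|c IHc].
  by apply: eq_epos (epos_0 n) => i; rewrite mul0r.
by apply: eq_epos (eposD Fpos IHc) => i; rewrite mulrS mulrDl mul1r.
Qed.

Lemma epos_sum (n k : nat) (F : nat -> 'I_N -> R) :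
  (forall j, (j < k)%N -> epos n (F j)) -> epos n (fun i => \sum_(j < k) F j i).
Proof.
elim: k => [|k IHk] Fpos.
  by apply: eq_epos (epos_0 n) => i; rewrite big_ord0.
have Fk_pos := IHk (fun j lt_jk => Fpos j (ltnW lt_jk)).
by apply: eq_epos (eposD Fk_pos (Fpos k (ltnSn k))) => i; rewrite big_ord_recr.
Qed.

Lemma zip_nseq (T U : Type) (c : T) (u : seq U) :
  zip (nseq (size u) c) u = [seq (c, a) | a <- u].
Proof. by elim: u => //= a u ->. Qed.

Lemma uniq_zip_nseq (T U : eqType) (c : T) (u : seq U) :
  uniq (zip (nseq (size u) c) u) = uniq u.
Proof. by rewrite zip_nseq map_inj_uniq // => a b []. Qed.

Lemma scaler_inv_nat (k : nat) (a : R) : (k != 0)%N ->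
  (k%:R^-1 : rat) *: (k%:R * a) = a.
Proof.
move=> k_neq0; rewrite -scaler_nat -scalerAl mul1r scalerA mulVf ?scale1r //.
by rewrite pnatr_eq0.
Qed.

(** One block of all n + 1 positions: the other n letters are distinct and differ from [i], and each
    monomial arises n! times. *)
Lemma epos_point (n : nat) : epos n (fun i => e' i n).
Proof.
exists [:: ((n`!%:R)^-1, nseq n.+1 0%N)].
  by rewrite /= size_nseq eqxx invr_ge0 ler0n.
move=> i; rewrite big_seq1 /clique_sum /=.
rewrite -[LHS](@scaler_inv_nat n`!) ?gtn_eqF ?fact_gt0 //; congr (_ *: _).
rewrite -wsum_uniq; apply: eq_wsum => v sz_v; congr (_%:R * _).
have -> : (0%N :: nseq n 0%N) = nseq (size (rcons v i)) 0%N.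
  by rewrite size_rcons sz_v.
rewrite uniq_zip_nseq rcons_uniq andbC; congr (_ && _).
by elim: (v) => //= a w ->; rewrite !inE negb_or eq_sym.
Qed.

(** The factor e_k is a new block of k positions put in front, with a color larger than all the
    others; each of its monomials arises k! times. *)
Lemma epos_elsym (k n : nat) (F : 'I_N -> R) :
  epos n F -> epos (k + n) (fun i => e k * F i).
Proof.
move=> [s s_ok FE]; pose c (cs : seq nat) := (\max_(j <- cs) j).+1.
exists [seq (q.1 / k`!%:R, nseq k (c q.2) ++ q.2) | q <- s].
  rewrite all_map; apply: sub_all s_ok => -[a cs] /= /andP[a_ge0 /eqP sz_cs].
  by rewrite mulr_ge0 ?invr_ge0 ?ler0n // size_cat size_nseq sz_cs addnS eqxx.
move=> i; rewrite FE mulr_sumr big_map [LHS]big_seq [RHS]big_seq.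
apply: eq_bigr => -[a cs] /= qs; have /andP[_ /= /eqP sz_cs] := allP s_ok _ qs.
rewrite -scalerAr -scalerA; congr (_ *: _).
rewrite -[LHS](@scaler_inv_nat k`!) ?gtn_eqF ?fact_gt0 //; congr (_ *: _).
rewrite mulrA -wsum_uniq /clique_sum wsum_cat -wsum_mulr.
apply: eq_wsum => u sz_u; rewrite -wsum_mull; apply: eq_wsum => v sz_v.
rewrite rcons_cat zip_cat ?size_nseq // mon_cat cat_uniq -[in nseq k _]sz_u.
rewrite uniq_zip_nseq.
have -> : has (mem (zip (nseq (size u) (c cs)) u)) (zip cs (rcons v i)) = false.
  apply/hasP => -[[j b] /(map_f fst)]; rewrite -/(unzip1 _) unzip1_zip; last first.
    by rewrite size_rcons sz_cs sz_v.
  move=> /= j_cs; rewrite /= zip_nseq => /mapP[? _ [jc _]].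
  by have := leq_bigmax_seq (P := xpredT) (F := id) j j_cs isT; rewrite /= jc /c ltnn.
have -> : all (mem [set: 'I_N]) u by apply/allP => b _; rewrite !inE.
by rewrite andbT /= -mulnb natrM; ring.
Qed.

(** By its recursion, [path_coef] is a polynomial in the e_j with nonnegative coefficients. *)
Lemma epos_path_coef (k n : nat) (F : 'I_N -> R) :
  epos n F -> epos (k + n) (fun i => path_coef x k * F i).
Proof.
elim/ltn_ind: k => -[|k] IHk Fpos.
  by apply: eq_epos Fpos => i; rewrite mul1r.
pose G j i := j%:R * (e j.+1 * (path_coef x (k - j) * F i)).
apply: (@eq_epos _ (fun i => \sum_(j < k.+1) G j i)) => [i|].
  rewrite path_coefS /conv mulr_suml; apply: eq_bigr => j _.
  by rewrite /G subSS !mulrA.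
apply: epos_sum => j; rewrite ltnS => le_jk; apply: epos_nat.
have -> : (k.+1 + n = j.+1 + (k - j + n))%N by rewrite addnA !addSn subnKC.
by apply/epos_elsym/IHk; rewrite ?ltnS ?leq_subr.
Qed.

Lemma epos_conv (k n : nat) (F : nat -> 'I_N -> R) :
  (forall j, epos (j + n) (F j)) ->
  epos (k + n) (fun i => conv x (fun j => F j i) k.+1).
Proof.
move=> Fpos.
apply: (epos_sum (F := fun j i => F j i * path_coef x (k.+1 - j.+1))) => j lt_jk.
apply: (@eq_epos _ (fun i => path_coef x (k - j) * F j i)) => [i|].
  by rewrite mulrC subSS.
have -> : (k + n = k - j + (j + n))%N by rewrite addnA subnK.
exact: epos_path_coef.
Qed.

Lemma epos_chorded (k : nat) : (1 < k)%N ->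
  epos k.+2
    (fun i => wsum k.+2 (fun v => (chorded_word i k.+1 (rcons v i))%:R * mon v)).
Proof.
case: k => // k k_gt1.
have sumE i := etrans (wsum_chorded i (ltnW k_gt1)) (closed_walk_chord x i k_gt1).
apply: (eq_epos (fun i => esym (sumE i))); rewrite -[k.+3]addn3.
apply: eposD; first apply: eposD.
- have -> : (k + 3 = k.+2 + 1)%N by rewrite addn3 addn1.
  by apply: eq_epos (epos_path_coef k.+2 (epos_point 1)) => i; rewrite mulrC.
- apply: epos_conv => j; apply: epos_nat; rewrite addn3; exact: epos_point.
apply: epos_conv => j; apply: epos_nat.
apply: eposD; first apply: eposD; first apply: eposD.
- apply: epos_nat; rewrite addn3 -[j.+3]addn0.
  (* Here the last position is a block by itself, through e'_0 = 1. *)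
  apply: eq_epos (epos_elsym j.+3 (epos_point 0)) => i.
  by rewrite elsym0 mulr1 addn0.
- apply: epos_nat; have -> : (j + 3 = j.+2 + 1)%N by rewrite addn3 addn1.
  exact: epos_elsym (epos_point 1).
- by rewrite addn3; exact: (epos_elsym 1 (epos_point j.+2)).
- by rewrite addn3; apply: epos_nat (epos_point _).
Qed.

End WordSums.

(** * Expansions in the e-basis *)

Section Spanning.

Variable d : nat.
Implicit Types (s t u : 'S_d) (w : d.-tuple nat) (f g : ncseries d).

Definition spans f : Prop := exists c, e_expansion f c.

Lemma eq_spans f g : f =1 g -> spans f -> spans g.
Proof. by move=> eqfg [c fE]; exists c => w; rewrite -eqfg. Qed.

Lemma spans_e (pi : {set {set 'I_d}}) :
  pi \in set_partitions d -> spans (ncsym_e pi).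
Proof.
move=> pi_part; exists (fun sigma => (sigma == pi)%:R) => w.
rewrite (bigD1 pi) //= eqxx mul1r big1 ?addr0 // => sigma /andP[_ /negPf ->].
by rewrite mul0r.
Qed.

Lemma spans_lin (a : rat) f g :
  spans f -> spans g -> spans (fun w => f w + a * g w).
Proof.
move=> [c fE] [c' gE]; exists (fun sigma => c sigma + a * c' sigma) => w.
rewrite fE gE mulr_sumr -big_split; apply: eq_bigr => sigma _ /=.
by rewrite mulrDl mulrA.
Qed.

Lemma spans0 : spans (fun=> 0).
Proof. by exists (fun=> 0) => w; rewrite big1 // => sigma _; rewrite mul0r. Qed.

Lemma spans_sum (I : finType) (P : pred I) (a : I -> rat) (F : I -> ncseries d) :
  (forall i, P i -> spans (F i)) -> spans (fun w => \sum_(i | P i) a i * F i w).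
Proof.
move=> Fspan; pose F' (i : I) : ncseries d := if P i then F i else fun=> 0.
have F'span i : spans (F' i).
  by rewrite /F'; case: ifP => [/Fspan // | _]; exact: spans0.
apply: (@eq_spans (fun w => \sum_i a i * F' i w)) => [w|].
  rewrite [RHS]big_mkcond; apply: eq_bigr => i _.
  by rewrite /F'; case: ifP => // _; rewrite mulr0.
elim: (index_enum I) => [|i r IHr].
  by apply: eq_spans spans0 => w; rewrite big_nil.
apply: eq_spans (spans_lin (a i) IHr (F'span i)) => w.
by rewrite big_cons addrC.
Qed.

(** * Words constant on the cycles of a permutation *)

Definition invariant_word s w : bool := [forall i, tnth w (s i) == tnth w i].

Lemma invariant_wordP s w :
  reflect (forall i j, j \in porbit s i -> tnth w j = tnth w i)
          (invariant_word s w).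
Proof.
apply: (iffP forallP) => [w_inv i j /porbitP[n ->] | w_inv i].
  elim: n => [|n IHn]; first by rewrite expg0 perm1.
  by rewrite expgSr permM (eqP (w_inv _)).
by apply/eqP/w_inv; exact: (mem_porbit s 1 i).
Qed.

(** For a word counted by e_pi the matrix is the identity; otherwise two positions of one block with
    equal letters give equal rows. *)
Lemma ncsym_e_det (pi : {set {set 'I_d}}) w :
  ncsym_e pi w =
  \det (\matrix_(i, j) ((pblock pi i == pblock pi j)
                        && (tnth w i == tnth w j))%:R : 'M[rat]_d).
Proof.
rewrite /ncsym_e; set b := [forall j, _].
have [/forallP w_proper | ] := boolP b.
  rewrite -[LHS](det1 rat d); congr (\det _); apply/matrixP => i j; rewrite !mxE.
  have [<- | neq_ij] := eqVneq i j; first by rewrite !eqxx.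
  have /forallP/(_ j)/implyP := w_proper i; rewrite neq_ij /=.
  by case: (_ == _) => //= /(_ isT) /negPf ->.
rewrite negb_forall => /existsP[i]; rewrite negb_forall => /existsP[j].
rewrite negb_imply negbK => /andP[/andP[neq_ij /eqP eq_pi] /eqP eq_w].
apply/esym/(determinant_alternate neq_ij) => k.
by rewrite !mxE eq_pi eq_w.
Qed.

Lemma ncsym_e_perm (pi : {set {set 'I_d}}) w :
  ncsym_e pi w = \sum_(s : 'S_d | [forall i, pblock pi i == pblock pi (s i)])
                   (-1) ^+ s * (invariant_word s w)%:R.
Proof.
rewrite ncsym_e_det /determinant [RHS]big_mkcond; apply: eq_bigr => s _.
under eq_bigr do rewrite mxE.
case: ifPn => [/forallP s_pi | /forallPn[i /negPf s_pi]]; last first.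
  by rewrite (bigD1 i) //= s_pi mul0r mulr0.
congr (_ * _); have [/forallP w_inv | ] := boolP (invariant_word s w).
  by rewrite big1 // => i _; rewrite s_pi eq_sym w_inv.
case/forallPn => i /negPf w_i.
by rewrite (bigD1 i) //= s_pi eq_sym w_i mul0r.
Qed.

Lemma porbits_partition s : porbits s \in set_partitions d.
Proof.
rewrite inE; apply/and3P; split.
- apply/eqP/setP => i; rewrite !inE; apply/bigcupP; exists (porbit s i).
    exact: imset_f.
  exact: porbit_id.
- apply/trivIsetP => _ _ /imsetP[i _ ->] /imsetP[j _ ->].
  apply: contraNT; rewrite -setI_eq0 => /set0Pn[k].
  by rewrite inE -!eq_porbit_mem => /andP[/eqP -> /eqP ->].
- by apply/imsetP => -[i _ /setP/(_ i)]; rewrite inE porbit_id.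
Qed.

Lemma pblock_porbits s i : pblock (porbits s) i = porbit s i.
Proof.
have := porbits_partition s; rewrite inE => /and3P[_ tI _].
by apply: def_pblock (imset_f _ _) (porbit_id s i).
Qed.

Lemma porbit_sub s t :
  (forall i, t i \in porbit s i) -> forall i, porbit t i \subset porbit s i.
Proof.
move=> st i; apply/subsetP => _ /porbitP[n ->].
elim: n => [|n IHn]; first by rewrite expg0 perm1 porbit_id.
rewrite expgSr permM -eq_porbit_mem; move: IHn; rewrite -eq_porbit_mem => /eqP <-.
by rewrite eq_porbit_mem.
Qed.

(* In the expansion of [ncsym_e (porbits s)], every permutation either has the
   orbits of [s], hence the same sign and invariant words, or strictly smaller
   orbits. *)
Lemma spans_invariant s : spans (fun w => (invariant_word s w)%:R).
Proof.
have [n] := ubnP (\sum_i #|porbit s i|); elim: n s => // n IHn s.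
rewrite ltnS => le_s_n.
pose P t := [forall i, pblock (porbits s) i == pblock (porbits s) (t i)].
have P_sub t : P t -> forall i, porbit t i \subset porbit s i.
  move=> /forallP Pt; apply: porbit_sub => i.
  by have := Pt i; rewrite !pblock_porbits eq_porbit_mem porbit_sym.
pose Q t := [forall i, porbit t i == porbit s i].
(* Equal orbits give equal signs, since the sign depends only on the number of orbits. *)
have QE t w : Q t -> (-1) ^+ t * (invariant_word t w)%:R
                     = (-1) ^+ s * (invariant_word s w)%:R :> rat.
  move=> /forallP Qt; have Q_eq i := eqP (Qt i); congr ((-1) ^+ _ * _%:R).
    rewrite /odd_perm; congr (nat_of_bool (_ (+) odd #|pred_of_set _|)).
    by apply: eq_imset.
  congr nat_of_bool.
  by apply/invariant_wordP/invariant_wordP => w_inv i j ij; apply: w_inv;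
    [rewrite Q_eq | rewrite -Q_eq].
have small t : P t && ~~ Q t -> spans (fun w => (invariant_word t w)%:R).
  move=> /andP[/P_sub sub_ts /forallPn[i neq_i]]; apply: IHn.
  apply: leq_trans le_s_n.
  rewrite (bigD1 i) //= [in leqRHS](bigD1 i) //= -addSn leq_add //.
    by apply: proper_card; rewrite properEneq neq_i sub_ts.
  by apply: leq_sum => j _; apply: subset_leq_card.
pose K := #|[pred t | P t && Q t]|.
have K_neq0 : K%:R != 0 :> rat.
  rewrite pnatr_eq0 -lt0n; apply/card_gt0P; exists s; rewrite inE.
  apply/andP; split; last by apply/forallP.
  apply/forallP => i; rewrite !pblock_porbits eq_porbit_mem porbit_sym.
  exact: (mem_porbit s 1 i).
(* Removing the permutations with smaller orbits leaves [K] equal terms, hence the later division by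
   [K] and by the sign of [s]. *)
have rest := spans_lin (-1) (spans_e (porbits_partition s))
  (spans_sum (fun t => (-1) ^+ t) small).
apply: eq_spans (spans_lin (K%:R^-1 * (-1) ^+ s) spans0 rest) => w.
rewrite add0r ncsym_e_perm (bigID Q) /= mulN1r addrK.
under eq_bigr => t /andP[_ Qt] do rewrite QE //.
rewrite sumr_const (_ : #|_| = K) // -[X in _ * X]mulr_natl mulrACA mulVf // mul1r mulrA.
by rewrite -signr_addb addbb mul1r.
Qed.

(** Two cycles are merged: the product agrees with [s] away from [i] and [j] and sends [i] to [s j],
    so from [i] it follows the [s]-orbit of [j], which avoids [i], until it reaches [j]. *)
Lemma porbit_tperm s i j : j \notin porbit s i -> j \in porbit (tperm i j * s) i.
Proof.
move=> s_ij; set u := (_ * s)%g.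
have u_step k : k \in porbit u i -> u k \in porbit u i.
  by move/porbitP => [n ->]; rewrite -permM -expgSr mem_porbit.
have orb n : j \in porbit u i \/ (s ^+ n.+1)%g j \in porbit u i.
  elim: n => [|n [|IHn]]; [right | by left | ].
    rewrite expg1; have <- : u i = s j by rewrite permM tpermL.
    exact/u_step/porbit_id.
  have [eq_j | neq_j] := eqVneq ((s ^+ n.+1)%g j) j; first by left; rewrite -eq_j.
  right; rewrite expgSr permM.
  have <- : u ((s ^+ n.+1)%g j) = s ((s ^+ n.+1)%g j); last exact: u_step.
  rewrite permM tpermD 1?eq_sym //; apply: contraNneq s_ij => <-.
  by rewrite porbit_sym mem_porbit.
by have [//|] := orb #[s]%g.-1; rewrite prednK // expg_order perm1.
Qed.

(** If [i] and [j] lie in one cycle of [s], the equality is implied; otherwise a transposition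
    merges their cycles. *)
Lemma invariant_word_edge s i j : exists u, forall w,
  invariant_word u w = invariant_word s w && (tnth w i == tnth w j).
Proof.
have [s_ij | s_ij] := boolP (j \in porbit s i).
  exists s => w; case: invariant_wordP => // w_inv.
  by rewrite (w_inv i j s_ij) eqxx.
exists (tperm i j * s)%g => w; set u := (_ * s)%g.
have tw : tnth w i = tnth w j -> forall k, tnth w (tperm i j k) = tnth w k.
  by move=> w_ij k; case: tpermP => [->|->|].
apply/idP/andP => [u_inv | [/forallP w_inv /eqP w_ij]].
  have w_ij : tnth w i = tnth w j.
    by rewrite (invariant_wordP _ _ u_inv _ _ (porbit_tperm s_ij)).
  split; last exact/eqP.
  apply/forallP => k; have -> : s k = u (tperm i j k) by rewrite permM tpermK.
  by rewrite (eqP (forallP u_inv _)) tw.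
by apply/forallP => k; rewrite permM (eqP (w_inv _)) tw.
Qed.

(** The product over the edges of 1 - [w_i = w_j] is expanded one edge at a time, each equality
    being absorbed into the permutation. The start is the identity, under which every word is
    invariant. *)
Lemma spans_chromatic (G : rel 'I_d) : spans (chromatic_ncsym G).
Proof.
pose F (l : seq ('I_d * 'I_d)) w : rat :=
  \prod_(p <- l) (1 - (tnth w p.1 == tnth w p.2)%:R).
have spansF l s : spans (fun w => (invariant_word s w)%:R * F l w).
  elim: l s => [|[i j] l IHl] s.
    by apply: eq_spans (spans_invariant s) => w; rewrite /F big_nil mulr1.
  have [u uE] := invariant_word_edge s i j.
  apply: eq_spans (spans_lin (-1) (IHl s) (IHl u)) => w.
  by rewrite uE /F big_cons /= -mulnb natrM; ring.
apply: eq_spans (spansF [seq p <- enum {: 'I_d * 'I_d} | G p.1 p.2] 1%g) => w.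
have -> : invariant_word 1 w by apply/forallP => i; rewrite perm1.
rewrite mul1r /F /chromatic_ncsym big_filter big_enum_cond /=.
have [/forallP w_proper | ] := boolP (proper_coloring G (tnth w)).
  rewrite big1 // => -[i j] /= Gij.
  by have /forallP/(_ j)/implyP/(_ Gij)/negPf -> := w_proper i; rewrite subr0.
case/forallPn => i /forallPn[j]; rewrite negb_imply negbK => /andP[Gij w_ij].
by rewrite (bigD1 (i, j)) //= w_ij subrr mul0r.
Qed.

End Spanning.

(** * Averaging over permutations fixing the last position *)

Section PermAction.

Variable d : nat.
Implicit Types (s t : 'S_d) (pi : {set {set 'I_d}}).

Definition permute_partition s pi : {set {set 'I_d}} :=
  [set s @: (B : {set 'I_d}) | B in pi].

Definition permute_word (T : Type) s (w : d.-tuple T) : d.-tuple T :=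
  [tuple tnth w (s i) | i < d].

Lemma permute_partitionK s :
  cancel (permute_partition s) (permute_partition s^-1).
Proof.
move=> pi; rewrite /permute_partition -imset_comp.
rewrite (eq_imset (g := id)) ?imset_id // => B /=.
rewrite -imset_comp (eq_imset (g := id)) ?imset_id // => i /=; exact: permK.
Qed.

Lemma permute_partition_inj s : injective (permute_partition s).
Proof. exact: can_inj (permute_partitionK s). Qed.

Lemma permute_partition_part s pi :
  pi \in set_partitions d -> permute_partition s pi \in set_partitions d.
Proof.
rewrite !inE => /and3P[/eqP cov /trivIsetP tI no0]; apply/and3P; split.
- apply/eqP/setP => i; rewrite inE; apply/bigcupP.
  have : s^-1%g i \in cover pi by rewrite cov inE.
  case/bigcupP => B piB iB; exists (s @: B); first exact: imset_f.
  by rewrite -[i](permKV s) imset_f.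
- apply/trivIsetP => _ _ /imsetP[A piA ->] /imsetP[B piB ->] neqAB.
  rewrite -setI_eq0 -imsetI; last by move=> i j _ _; apply: perm_inj.
  have /tI : A != B by apply: contraNneq neqAB => ->.
  by rewrite -setI_eq0 => /(_ piA piB)/eqP ->; rewrite imset0.
- apply: contraNN no0 => /imsetP[B piB /esym/eqP].
  by rewrite imset_eq0 => /eqP <-.
Qed.

Lemma permute_partition_in s pi :
  (permute_partition s pi \in set_partitions d) = (pi \in set_partitions d).
Proof.
apply/idP/idP; last exact: permute_partition_part.
by move/(permute_partition_part s^-1); rewrite permute_partitionK.
Qed.

Lemma pblock_permute s pi i : pi \in set_partitions d ->
  pblock (permute_partition s pi) (s i) = s @: pblock pi i.
Proof.
move=> pi_part; have := permute_partition_part s pi_part.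
rewrite !inE => /and3P[_ tI _]; move: pi_part; rewrite inE => /and3P[/eqP cov _ _].
apply: def_pblock => //; apply: imset_f; last by rewrite mem_pblock cov inE.
by rewrite pblock_mem // cov inE.
Qed.

Lemma ncsym_e_permute s pi (w : d.-tuple nat) : pi \in set_partitions d ->
  ncsym_e (permute_partition s pi) w = ncsym_e pi (permute_word s w).
Proof.
move=> pi_part; rewrite /ncsym_e; congr (nat_of_bool _)%:R; apply/forallP/forallP => w_ok i.
  apply/forallP => j; have /forallP/(_ (s j)) := w_ok (s i).
  rewrite !pblock_permute // (inj_eq perm_inj) !tnth_mktuple.
  by rewrite (inj_eq (imset_inj (@perm_inj _ s))).
apply/forallP => j; rewrite -[i](permKV s) -[j](permKV s).
have /forallP/(_ (s^-1 j)%g) := w_ok (s^-1 i)%g.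
rewrite !pblock_permute // !(inj_eq perm_inj) !tnth_mktuple.
by rewrite (inj_eq (imset_inj (@perm_inj _ s))).
Qed.

Lemma partition_type_permute s pi :
  partition_type (permute_partition s pi) = partition_type pi.
Proof.
have s_inj := imset_inj (@perm_inj _ s).
apply/perm_sortP.
- by move=> a b; exact: leq_total.
- by move=> a b c /= ba ac; exact: leq_trans ac ba.
- by move=> a b /andP[ba ab]; apply/eqP; rewrite eqn_leq; apply/andP.
have -> : [seq #|B| | B : {set 'I_d} in pi]
    = [seq #|pred_of_set B| | B <- [seq s @: (B : {set 'I_d}) | B <- enum pi]].
  rewrite -map_comp; apply: eq_map => B /=; rewrite card_imset //.
  exact: perm_inj.
apply: perm_map; apply: uniq_perm.
- exact: enum_uniq.
- by rewrite map_inj_uniq ?enum_uniq.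
move=> B; rewrite mem_enum.
apply/imsetP/mapP => -[A piA ->]; exists A => //; first by rewrite mem_enum.
by rewrite mem_enum in piA.
Qed.

End PermAction.

Section Averaging.

Variable n : nat.
Implicit Types (s t : 'S_n.+1) (pi sigma : {set {set 'I_n.+1}}).

Local Notation fixes_last := (fun s : 'S_n.+1 => s ord_max == ord_max).

Lemma partition_equiv_permute s pi sigma : s ord_max = ord_max ->
  sigma \in set_partitions n.+1 ->
  partition_equiv pi (permute_partition s sigma) = partition_equiv pi sigma.
Proof.
move=> s_last sigma_part; rewrite /partition_equiv partition_type_permute.
have := pblock_permute s ord_max sigma_part; rewrite s_last => eq_last.
by rewrite /last_block_size eq_last card_imset //; exact: perm_inj.
Qed.

(* The difference [c0 - a] of the two expansions has zero average, so subtracting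
   from [c0] the average of its permuted copies does not change the expanded
   series, while the class sums become those of [a]. *)
Lemma class_e_positive_average (G : rel 'I_n.+1) (a : {set {set 'I_n.+1}} -> rat) :
  (forall pi, 0 <= a pi) ->
  (forall w : n.+1.-tuple nat, \sum_(s | fixes_last s)
     (chromatic_ncsym G (permute_word s w)
      - \sum_(sigma in set_partitions n.+1)
          a sigma * ncsym_e sigma (permute_word s w)) = 0) ->
  class_e_positive G.
Proof.
move=> a_ge0 avg0; have [c0 GE] := spans_chromatic G.
pose b sigma := c0 sigma - a sigma.
pose M : rat := #|[pred s | fixes_last s]|%:R.
have M_neq0 : M != 0.
  rewrite pnatr_eq0 -lt0n; apply/card_gt0P; exists 1%g.
  by rewrite inE perm1.
pose c sigma := c0 sigma
  - M^-1 * \sum_(s | fixes_last s) b (permute_partition s^-1 sigma).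
exists c; split=> [w | pi pi_part].
  under eq_bigr do rewrite mulrBl -mulrA mulr_suml.
  rewrite sumrB -GE -mulr_sumr exchange_big /=.
  rewrite [X in _ * X](_ : _ = 0) ?mulr0 ?subr0 // -[RHS](avg0 w).
  apply: eq_bigr => s _; rewrite (reindex_inj (permute_partition_inj (s := s))) /=.
  rewrite GE -sumrB; apply: eq_big => [sigma | sigma].
    by rewrite permute_partition_in.
  rewrite permute_partition_in => sigma_part.
  by rewrite permute_partitionK ncsym_e_permute // mulrBl.
suff -> : class_coef c pi = class_coef a pi by apply: sumr_ge0.
rewrite /class_coef sumrB -mulr_sumr exchange_big /=.
(* Permutations fixing the last position preserve the class, so every permuted copy of [b] has the
   same class sum. *)
rewrite [X in _ * X](eq_bigr (fun=> \sum_(sigma in set_partitions n.+1 | partition_equiv pi sigma)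
                           b sigma)).
  rewrite sumr_const (_ : #|_| = #|[pred s | fixes_last s]|) //.
  rewrite -[X in _ * X]mulr_natl mulrA mulVf // mul1r -sumrB.
  by apply: eq_bigr => sigma _; rewrite /b opprB addrC subrK.
move=> s /eqP s_last; rewrite (reindex_inj (permute_partition_inj (s := s))) /=.
apply: eq_big => [sigma | sigma _]; last by rewrite permute_partitionK.
rewrite permute_partition_in; apply: andb_id2l => sigma_part.
exact: partition_equiv_permute.
Qed.

(* Monomials forget the order of all letters but the last, and the rearrangements
   of a word that keep its last letter form one orbit. *)
Lemma sum_permute_eq0 (T : finType) (H : n.+1.-tuple T -> rat)
    (v : n.+1.-tuple T) :
  \sum_(u : n.+1.-tuple T | perm_eq u v && (tnth u ord_max == tnth v ord_max)) H u
    = 0 ->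
  \sum_(s | fixes_last s) H (permute_word s v) = 0.
Proof.
pose X (u : n.+1.-tuple T) := perm_eq u v && (tnth u ord_max == tnth v ord_max).
move=> sumX0; set S := \sum_(s | _) _.
have permute_comp s t (u : n.+1.-tuple T) :
    permute_word s (permute_word t u) = permute_word (s * t)%g u.
  by apply: eq_from_tnth => i; rewrite !tnth_mktuple permM.
have permute_inj s : injective (@permute_word n.+1 T s).
  apply: (can_inj (g := permute_word s^-1%g)) => u.
  rewrite permute_comp mulVg; apply: eq_from_tnth => i.
  by rewrite tnth_mktuple perm1.
have perm_eq_permute s (u : n.+1.-tuple T) : perm_eq (permute_word s u) u.
  by apply/tuple_permP; exists s.
have SE u : X u -> \sum_(s | fixes_last s) H (permute_word s u) = S.
  case/andP => /tuple_permP[t ut] /eqP u_last.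
  have {}ut i : tnth u i = tnth v (t i).
    by have -> : u = permute_word t v; [exact: val_inj | rewrite tnth_mktuple].
  (* [t] is corrected to fix the last position. The word stays the same because [v] has equal
     letters at [t ord_max] and [ord_max]. *)
  pose t' := (t * tperm (t ord_max) ord_max)%g.
  have t'_last : t' ord_max = ord_max by rewrite permM tpermL.
  have -> : u = permute_word t' v.
    apply: eq_from_tnth => i; rewrite tnth_mktuple ut permM.
    by case: tpermP => // ->; rewrite -ut u_last.
  rewrite /S [RHS](reindex_inj (mulIg t')) /=; apply: eq_big => [s | s _].
    by rewrite permM -[X in _ = (_ == X)]t'_last (inj_eq perm_inj).
  by rewrite permute_comp.
have : \sum_(u | X u) \sum_(s | fixes_last s) H (permute_word s u) = 0.
  rewrite exchange_big big1 //= => s /eqP s_last.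
  rewrite -[RHS]sumX0 [RHS](reindex_inj (@permute_inj s)).
  apply: eq_bigl => u; rewrite /X tnth_mktuple s_last.
  by rewrite (permPl (perm_eq_permute s u)).
(* All inner sums equal [S] and [v] itself satisfies [X], so a nonzero multiple of [S] vanishes. *)
rewrite (eq_bigr _ SE) sumr_const => /eqP; rewrite mulrn_eq0 => /orP[|/eqP //].
by move/eqP/card0_eq/(_ v); rewrite unfold_in /X perm_refl eqxx.
Qed.

End Averaging.

Lemma wsum_tuple (R : comAlgType rat) (N k : nat) (F : seq 'I_N -> R) :
  wsum k F = \sum_(w : k.-tuple 'I_N) F w.
Proof.
elim: k F => [|k IHk] F /=.
  rewrite (eq_bigr (fun=> F [::])) => [|w _]; last by rewrite tuple0.
  by rewrite sumr_const card_tuple.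
under eq_bigr do rewrite IHk.
rewrite pair_big /= (reindex (fun p : 'I_N * k.-tuple 'I_N => cons_tuple p.1 p.2)) //=.
exists (fun w => (thead w, behead_tuple w)) => [[a w] _ | w _] /=.
  by congr (_, _); apply: val_inj.
by rewrite [RHS]tuple_eta; apply: val_inj.
Qed.

Lemma mcoeff_mon (N : nat) (u v : seq 'I_N) :
  (mon (fun i => 'X_i : {mpoly rat[N]}) u)@_(\sum_(i <- v) U_(i))%MM
  = (perm_eq u v)%:R.
Proof.
have -> : mon (fun i => 'X_i : {mpoly rat[N]}) u = 'X_[(\sum_(i <- u) U_(i))%MM].
  exact/esym/(big_morph (fun m => 'X_[m]) (@mpolyXD _ _) (@mpolyX0 _ _)).
rewrite mcoeffX; congr (nat_of_bool _)%:R.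
have countE (w : seq 'I_N) i : ((\sum_(j <- w) U_(j))%MM : 'X_{1.. N}) i = count_mem i w.
  by rewrite mnm_sumE -sum1_count [RHS]big_mkcond; apply: eq_bigr => j _; rewrite mnm1E.
apply/eqP/idP => [eq_uv | /seq.permP eq_uv].
  by apply/allP => i _ /=; rewrite -!countE eq_uv.
by apply/mnmP => i; rewrite !countE eq_uv.
Qed.

(** * The chorded cycle *)

Lemma chorded_wordP (T : eqType) (x0 : T) (m : nat) (w : m.+2.-tuple T) :
  reflect (forall i j, chorded_cycle i j -> tnth w i != tnth w j)
          (chorded_word x0 m w).
Proof.
have wE i : tnth w i = nth x0 w i by exact: tnth_nth.
apply: (iffP and3P) => [[/(sortedP x0) w_path w_ends w_chord] | w_ok].
  have edge (i j : 'I_m.+2) :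
      (j == ordS i) || (i == 1%N :> nat) && (j == m :> nat) ->
      tnth w i != tnth w j.
    case/orP => [/eqP -> | /andP[/eqP i1 /eqP jm]]; last first.
      by rewrite !wE i1 jm.
    rewrite !wE /=; have [lt_i | ge_i] := ltnP i.+1 m.+2.
      by rewrite modn_small // eq_sym w_path // size_tuple.
    have -> : i = m.+1 :> nat.
      by apply/eqP; rewrite eqn_leq -ltnS ltn_ord.
    by rewrite modnn eq_sym.
  by move=> i j /orP[/edge // | /edge]; rewrite eq_sym.
split.
- apply/(sortedP x0) => i; rewrite size_tuple => lt_i.
  rewrite eq_sym; have := w_ok (Ordinal (ltnW lt_i)) (Ordinal lt_i).
  rewrite !wE; apply; apply/orP; left; apply/orP; left.
  by apply/eqP/val_inj; rewrite /= modn_small.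
- have := w_ok (Ordinal (ltnSn m.+1)) ord0; rewrite !wE /= eq_sym; apply.
  apply/orP; left; apply/orP; left.
  by apply/eqP/val_inj; rewrite /= modnn.
have := w_ok (Ordinal (isT : (1 < m.+2)%N)) (Ordinal (ltnW (ltnSn m.+1))).
rewrite !wE; apply; apply/orP; left; apply/orP; right.
by rewrite /= !eqxx.
Qed.

(** * Set partitions from color sequences *)

Definition color_partition (d : nat) (cs : seq nat) : {set {set 'I_d}} :=
  preim_partition (fun i : 'I_d => nth 0%N cs i) setT.

Lemma color_partition_part (d : nat) (cs : seq nat) :
  color_partition d cs \in set_partitions d.
Proof. by rewrite inE preim_partitionP. Qed.

Lemma pblock_color (d : nat) (cs : seq nat) (i j : 'I_d) :
  (pblock (color_partition d cs) i == pblock (color_partition d cs) j)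
  = (nth 0%N cs i == nth 0%N cs j).
Proof.
have := color_partition_part d cs; rewrite inE => /and3P[/eqP cov tI _].
rewrite eq_pblock ?cov ?inE // pblock_equivalence_partition ?inE //.
by move=> a b c _ _ _ /=; split=> // /eqP ->.
Qed.

Lemma uniq_zip_color (T : eqType) (x0 : T) (d : nat) (cs : seq nat)
    (w : d.-tuple T) : size cs = d ->
  uniq (zip cs w) =
  [forall i, forall j, (i != j)
     && (pblock (color_partition d cs) i == pblock (color_partition d cs) j)
     ==> (tnth w i != tnth w j)].
Proof.
move=> sz_cs; have sz_w : size cs = size w by rewrite size_tuple.
have nthE i : nth (0%N, x0) (zip cs w) i = (nth 0%N cs i, nth x0 w i).
  exact: nth_zip.
have sz_zip : size (zip cs w) = d by rewrite size1_zip ?sz_w ?size_tuple.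
apply/(uniqP (0%N, x0))/forallP => [w_uniq i | w_ok i j].
  apply/forallP => j; apply/implyP; rewrite pblock_color => /andP[neq_ij /eqP eq_c].
  apply: contraNneq neq_ij; rewrite !(tnth_nth x0) => eq_w.
  by apply/eqP/val_inj/w_uniq; rewrite ?inE ?sz_zip ?ltn_ord // !nthE eq_c eq_w.
rewrite !inE sz_zip !nthE => lt_i lt_j [eq_c eq_w].
have /forallP/(_ (Ordinal lt_j)) := w_ok (Ordinal lt_i).
rewrite pblock_color !(tnth_nth x0) /= eq_c eq_w !eqxx andbT implybF negbK.
by move/eqP/(congr1 val).
Qed.

(** Proper colorings and the e_pi see only which letters coincide, so a word over [nat] can be
    replaced by one over a finite alphabet. *)
Definition same_pattern (d : nat) (T U : eqType) (w : d.-tuple T) (v : d.-tuple U) :=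
  forall i j, (tnth w i == tnth w j) = (tnth v i == tnth v j).

Lemma wsum_rcons (R : comAlgType rat) (N k : nat) (F : seq 'I_N -> R) :
  wsum k.+1 F = wsum k (fun u => \sum_a F (rcons u a)).
Proof.
rewrite -addn1 wsum_cat; apply: eq_wsum => u _ /=.
by apply: eq_bigr => a _; rewrite cats1.
Qed.

(** An identity of pointed commutative images, holding for every last letter, makes the averages in
    [class_e_positive_average] vanish. *)
Lemma class_e_positive_epos (n : nat) (G : rel 'I_n.+1)
    (P : forall T : eqType, T -> seq T -> bool) :
  (forall (T : eqType) (x0 : T) (w : n.+1.-tuple T),
     reflect (forall i j, G i j -> tnth w i != tnth w j) (P T x0 w)) ->
  epos (fun i => 'X_i : {mpoly rat[n.+1]}) n
    (fun i => wsum n (fun v => (P _ i (rcons v i))%:R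
                               * mon (fun i => 'X_i : {mpoly rat[n.+1]}) v)) ->
  class_e_positive G.
Proof.
move=> PP [qs qs_ok sumE]; set x := (fun i => 'X_i) in sumE.
pose a sigma := \sum_(q <- qs | color_partition n.+1 q.2 == sigma) q.1.
have aE (w : n.+1.-tuple nat) :
    \sum_(sigma in set_partitions n.+1) a sigma * ncsym_e sigma w
    = \sum_(q <- qs) q.1 * (uniq (zip q.2 w))%:R.
  rewrite [RHS]big_seq [RHS](partition_big
    (fun q : rat * seq nat => color_partition n.+1 q.2) (mem (set_partitions n.+1)));
    last by move=> q _; exact: color_partition_part.
  apply: eq_bigr => sigma _; rewrite /a mulr_suml [LHS]big_seq_cond.
  apply: eq_bigr => q /andP[q_qs /eqP <-].
  have /andP[_ /eqP sz_q] := allP qs_ok q q_qs.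
  by rewrite (uniq_zip_color 0%N).
have a_ge0 sigma : 0 <= a sigma.
  rewrite /a big_seq_cond; apply: sumr_ge0 => q /andP[q_qs _].
  by have /andP[] := allP qs_ok q q_qs.
apply: (class_e_positive_average a_ge0) => w.
pose H (u : seq 'I_n.+1) : rat :=
  (P _ ord0 u)%:R - \sum_(q <- qs) q.1 * (uniq (zip q.2 u))%:R.
(* Each letter is renamed to the place of its first occurrence in [w], so n + 1 variables
   suffice. *)
pose v : n.+1.-tuple 'I_n.+1 := [tuple inord (index (tnth w i) w) | i < n.+1].
have vw s : same_pattern (permute_word s w) (permute_word s v).
  move=> i j; rewrite !tnth_mktuple; apply/eqP/eqP => [-> // | /(congr1 val) /=].
  have lt_index k : (index (tnth w k) w < n.+1)%N.
    by rewrite -[X in (_ < X)%N](size_tuple w) index_mem mem_tnth.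
  by rewrite !inordK // => /(index_inj 0%N (mem_tnth _ _) (mem_tnth _ _)).
transitivity (\sum_(s : 'S_n.+1 | s ord_max == ord_max) H (permute_word s v)).
  apply: eq_bigr => s _; congr (_ - _).
    congr (nat_of_bool _)%:R; apply/idP/(PP _ ord0) => [/forallP w_ok i j Gij | v_ok].
      by have /forallP/(_ j)/implyP/(_ Gij) := w_ok i; rewrite (vw s).
    apply/forallP => i; apply/forallP => j; apply/implyP => Gij.
    by rewrite (vw s) v_ok.
  rewrite aE [LHS]big_seq [RHS]big_seq; apply: eq_bigr => q q_qs.
  have /andP[_ /eqP sz_q] := allP qs_ok q q_qs.
  rewrite (uniq_zip_color 0%N) // (uniq_zip_color ord0) //.
  congr (_ * (nat_of_bool _)%:R).
  by apply: eq_forallb => i; apply: eq_forallb => j; rewrite (vw s).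
apply: (sum_permute_eq0 (H := fun u : n.+1.-tuple 'I_n.+1 => H u)); set i := tnth v ord_max.
have P_i (u : n.+1.-tuple 'I_n.+1) : P _ i u = P _ ord0 u.
  by apply/(PP _ i)/(PP _ ord0).
(* Only words ending in [i] count here; after taking out the factor [x i] the sum vanishes by
   [sumE]. *)
have last_rcons_sum : wsum n.+1 (fun u => ((last i u == i)%:R * H u) *: mon x u) = 0.
  rewrite wsum_rcons.
  transitivity (x i * wsum n (fun u => H (rcons u i) *: mon x u)).
    rewrite -wsum_mull; apply: eq_wsum => u sz_u /=.
    rewrite (bigD1 i) //= big1 => [|b /negPf neq_bi].
      rewrite last_rcons eqxx mul1r addr0 -cats1 mon_cat {2}/mon big_seq1.
      by rewrite -scalerAr mulrC.
    by rewrite last_rcons neq_bi mul0r scale0r.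
  apply/eqP; rewrite mulf_eq0; apply/orP; right; apply/eqP.
  have := sumE i; rewrite /clique_sum => sumEi.
  transitivity (wsum n (fun u => (P _ i (rcons u i))%:R * mon x u)
    - \sum_(q <- qs) q.1 *: wsum n (fun u => (uniq (zip q.2 (rcons u i)))%:R * mon x u)).
    rewrite !wsum_tuple; under [X in _ - X]eq_bigr do rewrite wsum_tuple scaler_sumr.
    rewrite [X in _ - X]exchange_big -sumrB; apply: eq_bigr => u _ /=.
    rewrite /H -(P_i [tuple of rcons u i]) scalerBl scaler_suml; congr (_ - _).
      by rewrite scaler_nat mulr_natl.
    by apply: eq_bigr => q _; rewrite -scalerA scaler_nat mulr_natl.
  by rewrite -sumEi subrr.
(* The coefficient at the monomial of [v] selects the rearrangements of [v], here those with the
   same last letter. *)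
have := congr1 (mcoeff (\sum_(j <- v) U_(j))%MM) last_rcons_sum.
rewrite mcoeff0 wsum_tuple raddf_sum /= => sum0.
rewrite -[RHS]sum0 big_mkcond; apply: eq_bigr => u _ /=.
have -> : tnth u ord_max = last i u.
  by rewrite (tnth_nth i) -nth_last size_tuple.
rewrite mcoeffZ mcoeff_mon.
by case: (perm_eq u v); case: (last i u == i); rewrite ?mulr0 ?mulr1 ?mul1r ?mul0r.
Qed.

Theorem theorem4p3 (m : nat) (hm : (3 <= m)%N) :
  class_e_positive (@chorded_cycle m).
Proof.
apply: (class_e_positive_epos (P := fun T x0 w => @chorded_word T x0 m w)).
  by move=> T x0 w; exact: chorded_wordP.
(* With m = k + 1 the hypothesis becomes 1 < k, and the degree without the last letter is k + 2. *)
by case: m hm => // k k_gt1; exact: epos_chorded.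
Qed.
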